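(* Let $\ell,m\in\mathbb{N}$ with $\ell+m=n$, let $\tau>0$, and let $\boldsymbol{\alpha}\in W_\ell(\tau)\subset[0,1]^\ell$. Put $$s_n^{\boldsymbol{\alpha}}(\tau):=\dim\big((\{\boldsymbol{\alpha}\}\times[0,1]^m)\cap W_n(\tau)\big).$$ Then $$s_n^{\boldsymbol{\alpha}}(\tau)\ \ge\ s_n^{\ell}(\tau):=\begin{cases} m & \text{if }\tau\le \frac1n,\\[1ex] \dfrac{n+1}{\tau+1}-\ell & \text{if }\frac1n<\tau\le\frac1\ell,\\[1ex] \dfrac{m}{\tau+1} & \text{if }\tau>\frac1\ell.\end{cases}$$ Furthermore, $$\mathcal{H}^{s_n^\ell(\tau)}\big((\{\boldsymbol{\alpha}\}\times[0,1]^m)\cap W_n(\tau)\big)=\mathcal{H}^{s_n^\ell(\tau)}([0,1]^m).$$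
   Context: For $\mathbf{x}\in\mathbb{R}^k$, $\|\mathbf{x}\|=\min_{\mathbf{z}\in\mathbb{Z}^k}\max_j|x_j-z_j|$. For $k\in\mathbb{N}$ and $\tau>0$, $$W_k(\tau)=\{\mathbf{x}\in[0,1]^k:\ \|q\mathbf{x}\|<q^{-\tau}\text{ for infinitely many }q\in\mathbb{N}\}.$$ $\mathcal{H}^s$ denotes $s$-dimensional Hausdorff measure (diameters taken with respect to the max-norm) and $\dim$ denotes Hausdorff dimension. *)

(* Defs.v *)
From HB Require Import structures.
From mathcomp Require Import all_boot all_order all_algebra.
From mathcomp Require Import all_classical all_reals all_analysis.

Set Implicit Arguments.
Unset Strict Implicit.
Unset Printing Implicit Defensive.

Import Order.TTheory GRing.Theory Num.Theory.
Import numFieldNormedType.Exports.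

Local Open Scope classical_set_scope.
Local Open Scope ring_scope.

Section Hausdorff.
Context {R : realType} {T : normedModType R}.
Implicit Types (A U : set T) (s d : R).

(* diam set0 = -oo; the empty set is treated separately in diam_pow. *)
Definition diam U : \bar R :=
  ereal_sup [set `|x - y|%:E | x in U & y in U].

(* (diam U)^s. The empty set contributes 0 for every s, and a singleton
   contributes 0 `^ 0 = 1 for s = 0, so that s = 0 gives the counting measure. *)
Definition diam_pow s U : \bar R :=
  if U == set0 then 0%E else poweR (diam U) s.

Definition delta_cover d A (U : (set T)^nat) : Prop :=
  A `<=` \bigcup_i U i /\ forall i, (diam (U i) <= d%:E)%E.

Definition hausdorff_content s d A : \bar R :=
  ereal_inf [set (\sum_(0 <= i <oo) diam_pow s (U i))%E | U in delta_cover d A].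

(* The content increases as d decreases, so the supremum is the limit d -> 0. *)
Definition hausdorff_measure s A : \bar R :=
  ereal_sup [set hausdorff_content s d A | d in [set d | 0 < d]].

Definition hausdorff_dim A : \bar R :=
  ereal_inf [set s%:E | s in [set s | 0 <= s /\ hausdorff_measure s A = 0%E]].

End Hausdorff.

Section Diophantine.
Context {R : realType}.

(* On 'rV[R]_k the library norm `|x| is the max-norm. The infimum is a
   minimum: see nint_dist_attained. *)
Definition nint_dist (k : nat) (x : 'rV[R]_k) : R :=
  inf [set `|x - map_mx intr z| | z in [set: 'rV[int]_k]].

Definition unit_cube (k : nat) : set 'rV[R]_k :=
  [set x | forall j, 0 <= x ord0 j <= 1].

Definition W (k : nat) (tau : R) : set 'rV[R]_k :=
  @unit_cube k `&`
  [set x | infinite_set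
     [set q : nat | (0 < q)%N /\ nint_dist (q%:R *: x) < q%:R `^ (- tau)]].

Definition fiber (l m : nat) (alpha : 'rV[R]_l) : set 'rV[R]_(l + m) :=
  [set row_mx alpha y | y in @unit_cube m].

(* The exponent s_n^l(tau), with n = l + m. *)
Definition s_lower (l m : nat) (tau : R) : R :=
  let n := (l + m)%N in
  if tau <= n%:R^-1 then m%:R
  else if tau <= l%:R^-1 then (n.+1)%:R / (tau + 1) - l%:R
  else m%:R / (tau + 1).

Lemma nint_dist_attained (k : nat) (x : 'rV[R]_k) :
  exists2 z : 'rV[int]_k, nint_dist x = `|x - map_mx intr z| &
    forall z' : 'rV[int]_k, `|x - map_mx intr z| <= `|x - map_mx intr z'|.
Proof.
pose dn (t : R) : int :=
  if t - (Num.floor t)%:~R <= (Num.floor t + 1)%:~R - t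
  then Num.floor t else Num.floor t + 1.
have dnP (t : R) (c : int) : `|t - (dn t)%:~R| <= `|t - c%:~R|.
  rewrite /dn.
  have h1 : (Num.floor t)%:~R <= t by exact: floor_le_tmp.
  have h2 : t < (Num.floor t + 1)%:~R by exact: floorD1_gt.
  have [cf|fc] := lerP c (Num.floor t).
    have cf' : (c%:~R : R) <= (Num.floor t)%:~R by rewrite ler_int.
    rewrite [leRHS]ger0_norm ?subr_ge0 ?(le_trans cf')//.
    case: ifPn => [_|]; first by rewrite ger0_norm ?subr_ge0// lerB.
    rewrite -ltNge => /ltW h; rewrite ler0_norm ?subr_le0 ?(ltW h2)// opprB.
    by rewrite (le_trans h)// lerB.
  have cf' : ((Num.floor t + 1)%:~R : R) <= c%:~R by rewrite ler_int lezD1.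
  rewrite [leRHS]ler0_norm ?subr_le0 ?(ltW (lt_le_trans h2 cf'))// opprB.
  case: ifPn => [h|_].
    by rewrite ger0_norm ?subr_ge0// (le_trans h)// lerB.
  by rewrite ler0_norm ?subr_le0 ?(ltW h2)// opprB lerB.
have z0P (z : 'rV[int]_k) :
    `|x - map_mx intr (map_mx dn x)| <= `|x - map_mx intr z|.
  rewrite /Num.norm/= !mx_normrE; apply: le_bigmax2 => -[i j] _ /=.
  by rewrite !mxE dnP.
exists (map_mx dn x) => //; apply/eqP; rewrite eq_le; apply/andP; split.
- by apply: ge_inf; [exists 0 => _ [z _ <-]|exists (map_mx dn x)].
- by apply: lb_le_inf => [|_ [z _ <-]//]; exists `|x - map_mx intr 0|, 0.
Qed.

End Diophantine.

Arguments unit_cube {R} k.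
Arguments W {R} k tau.
Arguments fiber {R l} m alpha.
Arguments s_lower {R} l m tau.

(* Main.v *)
Require Import Defs.
From HB Require Import structures.
From mathcomp Require Import all_boot all_order all_algebra finmap.
From mathcomp Require Import all_classical all_reals all_analysis.
From mathcomp Require Import ring lra.
Import Order.TTheory GRing.Theory Num.Theory.
Import numFieldNormedType.Exports.
Local Open Scope classical_set_scope.
Local Open Scope ring_scope.

Set Implicit Arguments.
Unset Strict Implicit.
Unset Printing Implicit Defensive.

(** If [tau <= 1/n], Dirichlet's theorem makes [W n tau] the whole cube. Otherwise put
    [sigma = max 0 ((1 - l tau) / m)], so that [s (1 + tau) = m (1 + sigma)] for
    [s = s_lower l m tau], and [s < m]. Minkowski-type pigeonholing puts every [y] within
    [C q^(-1-sigma)] of a rational point [p/q] for infinitely many [q] with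
    [||q alpha|| < q^(-tau)]; points infinitely often within [q^(-1-tau)/2] of such [p/q]
    belong to the fibre. As [q^(-1-sigma)] is of order [(q^(-1-tau))^(s/m)], we are in the
    situation of the mass transference principle, and the s-measure of the fibre is
    infinite, as is that of the cube; the bound on the dimension follows.

    Infinite measure is obtained without constructing a measure. Given balls
    [B(u_j, d_j)] of small radii with [sum d_j^s] finite, call a ball [B] of radius [rho]
    sparse when the balls [B(u_j, d_j)] meeting it satisfy [sum d_j^m <= kappa rho^m]. A
    sparse ball contains sparse balls [B(p/q, q^(-1-tau)/2)] with [q] arbitrarily large, and
    the intersection point of the resulting nested sequence avoids all [B(u_j, d_j)], which
    hence do not cover the fibre. *)

(** * Finite families of balls *)

Lemma rV_norm_leP (R : realType) m (x : 'rV[R]_m) (e : R) : 0 <= e ->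
  reflect (forall i, `|x ord0 i| <= e) (`|x| <= e).
Proof.
move=> e0; rewrite /Num.norm/= mx_normrE; apply: (iffP idP) => [h i|h].
  apply: le_trans h; exact: (le_bigmax _ (fun ij => `|x ij.1 ij.2|) (ord0, i)).
by apply/bigmax_leP; split=> // -[i j] _ /=; rewrite ord1; exact: h.
Qed.

Lemma rV_coord_le_norm (R : realType) m (x : 'rV[R]_m) i : `|x ord0 i| <= `|x|.
Proof. exact: (elimT (rV_norm_leP _ (normr_ge0 x)) (lexx _)). Qed.

(** The indices counted lie within [2 * d / h] of the least one, so there are at most
    [2 * d / h + 1] of them; [h <= 2 * d] absorbs the 1. *)
Lemma card_ord_interval (R : realType) K (a h d : R) : 0 < h -> h <= 2 * d ->
  #|[set k : 'I_K | `|a + h * k%:R| <= d]%SET|%:R <= 4 * d / h.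
Proof.
move=> h0 hd; set A := [set k | _]%SET.
have memA k : (k \in A) = (`|a + h * k%:R| <= d) by rewrite /A finset.in_set.
have [->|] := eqVneq A finset.set0.
  by rewrite cards0 divr_ge0 ?(ltW h0)//; lra.
case/set0Pn => k0' k0'A; case: (arg_minnP (fun k : 'I_K => (k : nat)) k0'A) => k0 k0A k0min.
set T := Num.truncn (2 * d / h).
have dh0 : 0 <= 2 * d / h by rewrite divr_ge0 ?(ltW h0)//; lra.
have kT (k : 'I_K) : k \in A -> (k0 <= k < k0 + T.+1)%N.
  move=> kA; rewrite k0min//= addnS ltnS -leq_subLR /T truncn_ge_nat//.
  rewrite ler_pdivlMr// natrB ?k0min//.
  have : `|a + h * k%:R| <= d by rewrite -memA.
  have : `|a + h * k0%:R| <= d by rewrite -memA.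
  rewrite !ler_norml => /andP[? ?] /andP[? ?]; lra.
have : (#|A| <= T.+1)%N.
  rewrite -[leqRHS]card_ord -(card_in_imset (f := fun k : 'I_K => inord (k - k0) : 'I_T.+1)).
    exact: max_card.
  have ltT k : k \in A -> (k - k0 < T.+1)%N.
    by move=> /kT /andP[h1 h2]; rewrite ltn_subLR.
  move=> i j iA jA /(congr1 val); rewrite /= !inordK ?ltT//.
  have /andP[ki _] := kT _ iA; have /andP[kj _] := kT _ jA.
  by move=> /(congr1 (addn^~ k0)); rewrite !subnK// => /val_inj.
rewrite -(ler_nat R) => /le_trans; apply.
rewrite -natr1; have : T%:R <= 2 * d / h by rewrite truncn_le.
have : 1 <= 2 * d / h by rewrite ler_pdivlMr// mul1r.
have -> : 4 * d / h = 2 * d / h + 2 * d / h by lra.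
lra.
Qed.

Lemma exists_minorant (R : realType) (T : eqType) (s : seq T) (f : T -> R) :
  (forall x, x \in s -> 0 < f x) ->
  exists2 e : R, 0 < e & forall x, x \in s -> e <= f x.
Proof.
elim: s => [|x s IH] h; first by exists 1.
have [e e0 He] := IH (fun y ys => h y (@mem_behead _ (x :: s) y ys)).
exists (Num.min e (f x)); first by rewrite lt_min e0 h// mem_head.
by move=> y; rewrite inE ge_min => /orP[/eqP->|/He->//]; rewrite lexx orbT.
Qed.

(* Count points of a fine lattice; the factor 4 absorbs the rounding errors. *)
Lemma cube_cover_volume (R : realType) m (x : 'rV[R]_m) (rho : R)
    (s : seq ('rV[R]_m * R)) : 0 < rho ->
  (forall p, p \in s -> 0 < p.2) ->
  (forall y, `|y - x| <= rho -> exists2 p, p \in s & `|y - p.1| <= p.2) ->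
  rho ^+ m <= \sum_(p <- s) (4 * p.2) ^+ m.
Proof.
move=> rho0 s0 scov.
have [e e0 He] := exists_minorant (f := snd) s0.
(* [K] brings the mesh [h] below the lower bound [e] of the radii, as [card_ord_interval]
   requires. *)
pose K := (Num.truncn (rho / e)).+1.
have K0 : 0 < K%:R :> R by rewrite ltr0n.
have Kne : K%:R != 0 :> R by rewrite gt_eqF.
pose h := rho / K%:R.
have h0 : 0 < h by rewrite divr_gt0.
have he : h <= e.
  rewrite ler_pdivrMr// mulrC -ler_pdivrMr//.
  by apply/ltW; rewrite /K truncnS_gt.
pose z (f : {ffun 'I_m -> 'I_K}) : 'rV[R]_m := \row_i (x ord0 i + h * (f i)%:R).
pose S (p : 'rV[R]_m * R) : {set {ffun 'I_m -> 'I_K}} := [set f | `|z f - p.1| <= p.2]%SET.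
have zx f : `|z f - x| <= rho.
  apply/rV_norm_leP; first exact: ltW.
  move=> i; rewrite !mxE addrAC subrr add0r ger0_norm; last by rewrite mulr_ge0// ltW.
  rewrite /h mulrAC ler_pdivrMr// ler_pM2l// ler_nat; exact: ltnW.
have cardS p : p \in s -> #|S p|%:R <= (4 * p.2 / h) ^+ m.
  move=> ps; have p0 : 0 < p.2 := s0 _ ps.
  (* For the max-norm, [S p] is a product of one-dimensional sets. *)
  pose F i := [set k : 'I_K | `|x ord0 i - p.1 ord0 i + h * k%:R| <= p.2]%SET.
  have -> : #|S p| = #|family F|.
    apply: eq_card => f; rewrite inE.
    apply/rV_norm_leP/familyP; rewrite ?(ltW p0)// => H i;
      by move: (H i); rewrite !inE !mxE addrAC.
  rewrite card_family foldrE big_map natr_prod.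
  rewrite -[X in _ ^+ X]card_ord -prodr_const big_enum/=.
  apply: ler_prod => i _; rewrite ler0n/=.
  by apply: card_ord_interval => //; have := He _ ps; lra.
have : (K ^ m)%:R <= \sum_(p <- s) #|S p|%:R :> R.
  rewrite -natr_sum ler_nat.
  have -> : (K ^ m = \sum_(f : {ffun 'I_m -> 'I_K}) 1)%N.
    by rewrite sum1_card card_ffun !card_ord.
  under [leqRHS]eq_bigr do rewrite -sum1_card big_mkcond/=.
  rewrite exchange_big/=; apply: leq_sum => f _.
  have [p ps pz] := scov _ (zx f).
  by rewrite (big_rem p ps)/= inE pz.
move=> H.
have : (K ^ m)%:R <= \sum_(p <- s) (4 * p.2 / h) ^+ m :> R.
  apply: le_trans H _; rewrite big_seq [leRHS]big_seq.
  by apply: ler_sum => p; exact: cardS.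
under eq_bigr do rewrite expr_div_n.
rewrite -mulr_suml ler_pdivlMr ?exprn_gt0// natrX -exprMn.
by rewrite /h mulrCA divff// mulr1.
Qed.

Lemma exists_max_seq (R : realType) (T : eqType) (f : T -> R) (x : T) (s : seq T) :
  exists2 p, p \in x :: s & forall q, q \in x :: s -> f q <= f p.
Proof.
elim: s x => [|y s IH] x.
  by exists x; [rewrite mem_head|move=> q; rewrite inE => /eqP->].
have [p ps pmax] := IH y.
have [fxp|fpx] := leP (f x) (f p).
  exists p; first by rewrite inE ps orbT.
  by move=> q; rewrite inE => /orP[/eqP->//|/pmax].
exists x; first by rewrite mem_head.
move=> q; rewrite inE => /orP[/eqP->//|/pmax h]; exact: le_trans h (ltW fpx).
Qed.

(** Greedy selection: a ball of largest radius is kept, the balls too close to it are discarded, and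
    the rest is treated in the same way. A discarded ball is no larger than the one that discards
    it. *)
Lemma vitali_seq (R : realType) m (s : seq ('rV[R]_m * R)) (k : R) : 0 < k ->
  (forall p, p \in s -> 0 < p.2) ->
  exists D : seq ('rV[R]_m * R), [/\ uniq D, {subset D <= s},
    forall p q, p \in D -> q \in D -> p != q -> k * (p.2 + q.2) < `|p.1 - q.1| &
    forall p, p \in s -> exists2 q, q \in D &
      p.2 <= q.2 /\ `|p.1 - q.1| <= k * (p.2 + q.2)].
Proof.
move=> k0; have [n] := ubnP (size s); elim: n s => // n IH [|a s] sn s0.
  by exists [::]; split.
have [p0 p0s p0max] := exists_max_seq snd a s.
set s1 := a :: s in p0s p0max s0 sn *.
pose s' := [seq p <- s1 | k * (p.2 + p0.2) < `|p.1 - p0.1|].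
have p0s' : p0 \notin s'.
  rewrite mem_filter subrr normr0 ltNge mulr_ge0 ?(ltW k0)//.
  by have := s0 _ p0s; lra.
have ss' : (size s' < n)%N.
  rewrite -ltnS; apply: leq_trans _ sn.
  rewrite ltnS size_filter -(count_predC (fun p : 'rV[R]_m * R => k * (p.2 + p0.2) < `|p.1 - p0.1|) s1).
  rewrite -[X in (X < _)%N]addn0 ltn_add2l -has_count; apply/hasP; exists p0 => //=.
  by move: p0s'; rewrite mem_filter p0s andbT.
have [||D [uD Ds Dsep Dcov]] := IH s' => //.
  by move=> p; rewrite mem_filter => /andP[_ /s0].
have Dp0 p : p \in D -> k * (p.2 + p0.2) < `|p.1 - p0.1|.
  by move=> /Ds; rewrite mem_filter => /andP[].
exists (p0 :: D); split.
- by rewrite /= uD andbT; apply/negP => /Ds; exact/negP.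
- by move=> p; rewrite inE => /orP[/eqP->//|/Ds]; rewrite mem_filter => /andP[].
- move=> p q; rewrite !inE => /orP[/eqP->|pD] /orP[/eqP->|qD] pq.
  + by rewrite eqxx in pq.
  + by rewrite addrC distrC Dp0.
  + exact: Dp0.
  + exact: Dsep.
- move=> p ps.
  have [far|near] := ltP (k * (p.2 + p0.2)) `|p.1 - p0.1|.
    have [|q qD H] := Dcov p; first by rewrite mem_filter far.
    by exists q => //; rewrite inE qD orbT.
  by exists p0; [rewrite mem_head|split=> //; exact: p0max].
Qed.

(** [J] is an index whose partial sum comes within [e] of the supremum of all partial sums. *)
Lemma small_tail (R : realType) (a : nat -> R) (M e : R) :
  (forall j, 0 <= a j) -> (forall N, \sum_(0 <= j < N) a j <= M) -> 0 < e ->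
  exists J, forall N, \sum_(J <= j < N) a j <= e.
Proof.
move=> a0 aM e0.
pose S := [set \sum_(0 <= j < N) a j | N in setT].
have hS : has_sup S.
  by split; [exists (\sum_(0 <= j < 0) a j), 0%N|exists M => _ [N _ <-]].
have [_ [J _ <-] HJ] := sup_adherent e0 hS.
exists J => N; have [NJ|JN] := leqP N J; first by rewrite big_geq// ltW.
have : \sum_(0 <= j < N) a j <= sup S by apply: ub_le_sup; [case: hS|exists N].
by rewrite (big_cat_nat (n := J)) ?(ltnW JN)//=; lra.
Qed.

(** * Sparse balls *)

(** The inclusion of l^s in l^m: if S is the sum of the d_j^s, then d_j^m = d_j^s (d_j^s)^((m-s)/s)
    <= d_j^s S^((m-s)/s). *)
Lemma sum_exprn_le (R : realType) (P : pred nat) (d : nat -> R) (s : R) m N :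
  (forall j, 0 < d j) -> 0 < s -> s < m%:R ->
  \sum_(0 <= j < N | P j) d j ^+ m
    <= (\sum_(0 <= j < N | P j) d j `^ s) `^ (m%:R / s).
Proof.
move=> d0 s0 sm; set S := (X in _ <= X `^ _).
have S0 : 0 <= S by apply: sumr_ge0 => j _; exact: powR_ge0.
have dS j : j \in index_iota 0 N -> P j -> d j `^ s <= S.
  move=> jN Pj; rewrite /S (big_rem j jN)/= Pj.
  by rewrite lerDl; apply: sumr_ge0 => i _; exact: powR_ge0.
have [S_0|Sn0] := eqVneq S 0.
  rewrite big1_seq ?powR_ge0// => j /andP[Pj jN].
  by have := dS _ jN Pj; rewrite S_0 leNgt powR_gt0.
have -> : m%:R / s = 1 + (m%:R - s) / s by rewrite mulrBl divff ?gt_eqF// addrC subrK.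
rewrite powRD ?Sn0 ?implybT// powRr1// mulr_suml.
rewrite big_seq_cond [leRHS]big_seq_cond; apply: ler_sum => j /andP[jN Pj].
have {}dS := dS _ jN Pj.
rewrite -powR_mulrn ?(ltW (d0 j))//.
rewrite -[X in _ `^ X](subrK s) addrC powRD; last by rewrite (gt_eqF (d0 j)) implybT.
rewrite ler_wpM2l ?powR_ge0//.
have -> : d j `^ (m%:R - s) = (d j `^ s) `^ ((m%:R - s) / s).
  by rewrite -powRrM mulrC divfK// gt_eqF.
apply: ge0_ler_powR; rewrite ?nnegrE ?powR_ge0// divr_ge0// ?subr_ge0 ltW//.
Qed.

Lemma ler_sum_nat_widen (R : realType) (P : pred nat) (a : nat -> R) J N N' :
  (forall j, 0 <= a j) -> (N <= N')%N ->
  \sum_(J <= j < N | P j) a j <= \sum_(J <= j < N' | P j) a j.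
Proof.
move=> a0 NN'; have [NJ|JN] := leqP N J.
  by rewrite [leLHS]big_geq//; apply: sumr_ge0.
rewrite [leRHS](big_cat_nat (n := N)) ?(ltnW JN)//= lerDl.
exact: sumr_ge0.
Qed.

(** After exchanging the sums, each [a j] is counted for at most one [p]. *)
Lemma sum_disjoint_le (R : realType) (T : eqType) (D : seq T) (Q : T -> pred nat)
    (a : nat -> R) J N : uniq D -> (forall j, 0 <= a j) ->
  (forall p q j, p \in D -> q \in D -> Q p j -> Q q j -> p = q) ->
  \sum_(p <- D) \sum_(J <= j < N | Q p j) a j <= \sum_(J <= j < N) a j.
Proof.
move=> uD a0 Qinj.
under eq_bigr do rewrite big_mkcond/=.
rewrite exchange_big/=; apply: ler_sum => j _.
have [/hasP[p pD Qpj]|/hasPn noQ] := boolP (has (Q^~ j) D).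
  rewrite (bigD1_seq p)//= Qpj big1_seq ?addr0// => q /andP[qp qD].
  by case: ifPn => // Qqj; rewrite (Qinj q p j) ?eqxx in qp.
by rewrite big1_seq// => p /noQ/negPf->.
Qed.

Section shrinking.
Variables (R : realType) (m : nat) (s K : R) (u : nat -> 'rV[R]_m.+1) (d : nat -> R).
Local Notation n := m.+1.
Hypotheses (s0 : 0 < s) (sm : s < n%:R) (K0 : 0 < K) (d0 : forall j, 0 < d j).

Definition hits (x : 'rV[R]_n) (rho : R) : pred nat := fun j => `|u j - x| <= d j + rho.

(* With [24 = 4 * 3 * 2] the balls of radius [3 * d j], counted with the factor 4
   of [cube_cover_volume], fill at most half of the concentric ball of half radius. *)
Definition kappa : R := (2 * 24 ^+ n)^-1.

Definition sparse x rho : Prop :=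
  forall N, \sum_(0 <= j < N | hits x rho j) d j ^+ n <= kappa * rho ^+ n.

(* A triple [(c, r, t)] stands for the ball [B(c, r)] and its enlargement [B(c, t)],
   where [t] is of order [r `^ (s / n)]. *)
Definition good_triples (G : set ('rV[R]_n * R * R)) : Prop :=
  (forall c r t, G (c, r, t) -> [/\ 0 < r, r <= t & t ^+ n <= K * r `^ s]) /\
  (forall y e, 0 < e -> exists c r t, [/\ G (c, r, t), `|y - c| <= t & t <= e]).

Lemma kappa_gt0 : 0 < kappa.
Proof. by rewrite invr_gt0 mulr_gt0// exprn_gt0. Qed.

(** By [sum_exprn_le], a small sum of the d_j^s would, raised to the power n/s, give the sparsity
    bound. Failure of sparsity thus becomes a lower density bound for the masses d_j^s. *)
Lemma not_sparse x r : 0 < r -> ~ sparse x r ->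
  exists N, kappa `^ (s / n%:R) * r `^ s < \sum_(0 <= j < N | hits x r j) d j `^ s.
Proof.
move=> r0 /existsNP[N] /negP; rewrite -ltNge => H; exists N.
rewrite ltNge; apply/negP => H'.
move: H; rewrite ltNge => /negP; apply.
apply: le_trans (sum_exprn_le _ _ d0 s0 sm) _.
have ns0 : 0 < n%:R / s by rewrite divr_gt0// ltr0n.
apply: (@le_trans _ _ ((kappa `^ (s / n%:R) * r `^ s) `^ (n%:R / s))).
  apply: ge0_ler_powR; rewrite ?nnegrE ?(ltW ns0)//.
    by apply: sumr_ge0 => j _; exact: powR_ge0.
  by rewrite mulr_ge0 ?powR_ge0.
have n0 : n%:R != 0 :> R by rewrite pnatr_eq0.
have e1 : s / n%:R * (n%:R / s) = 1 by rewrite mulrA divfK// divff// gt_eqF.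
rewrite powRM ?powR_ge0// -!powRrM e1.
rewrite powRr1 ?(ltW kappa_gt0)// [s * _]mulrC divfK ?gt_eqF//.
by rewrite powR_mulrn ?(ltW r0).
Qed.

Lemma ball_compact (x : 'rV[R]_n) (r : R) : compact [set y : 'rV[R]_n | `|y - x| <= r].
Proof.
have [r0|r0] := ltP r 0.
  rewrite (_ : [set _ | _] = set0); first exact: compact0.
  by apply/seteqP; split => // y /= h; have := normr_ge0 (y - x); rewrite leNgt (le_lt_trans h).
pose A i : set R := [set` `[x ord0 i - r, x ord0 i + r]].
have -> : [set y : 'rV[R]_n | `|y - x| <= r] = [set v : 'rV[R]_n | forall i, A i (v ord0 i)].
  apply/seteqP; split => y /=.
    move=> /rV_norm_leP H i; move: (H r0 i); rewrite !mxE /A/= in_itv/= ler_norml; lra.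
  move=> H; apply/rV_norm_leP => // i; move: (H i); rewrite !mxE /A/= in_itv/= ler_norml; lra.
by apply: rV_compact => i; exact: segment_compact.
Qed.

(* If no ball of the family were sparse, every point outside the balls of radius
   [3 * d j] would have arbitrarily small neighbourhoods in which the atomic measure
   with mass [d j `^ s] at [u j] has density bounded below; but the density of an
   atomic measure vanishes almost everywhere, as the Vitali argument shows. *)
Lemma shrink (G : set ('rV[R]_n * R * R)) (M : R) x (rho e : R) : good_triples G ->
  (forall N, \sum_(0 <= j < N) d j `^ s <= M) ->
  0 < rho -> 0 < e -> sparse x rho ->
  exists c r, [/\ exists t, G (c, r, t), 0 < r <= e, `|c - x| + r <= rho & sparse c r].
Proof.
move=> [G1 G2] dM rho0 e0 xsp; apply: contrapT => H.
have {}H c r t : G (c, r, t) -> r <= e -> `|c - x| + r <= rho ->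
    exists N, kappa `^ (s / n%:R) * r `^ s < \sum_(0 <= j < N | hits c r j) d j `^ s.
  move=> Gcrt re crho; have [r0 _ _] := G1 _ _ _ Gcrt.
  apply: not_sparse => // csp; apply: H.
  by exists c, r; split=> //; [exists t|rewrite r0].
pose k2 := kappa `^ (s / n%:R) / K.
have k20 : 0 < k2 by apply: divr_gt0 => //; apply: powR_gt0; exact: kappa_gt0.
(* Here 12 = 4 * 3 and 28 = 4 * 7, with the 4 of [cube_cover_volume], the radii 3 d_j, and the
   Vitali enlargement by 7. With this [eps] the enlarged balls contribute at most half of the bound
   for the balls of radius 3 d_j. *)
pose eps := kappa * rho ^+ n * 12 ^+ n / 2 / 28 ^+ n * k2.
have eps0 : 0 < eps.
  by rewrite /eps !(mulr_gt0 _ k20, divr_gt0, exprn_gt0, mulr_gt0)// kappa_gt0.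
have [J HJ] := small_tail (fun j => powR_ge0 (d j) s) dM eps0.
pose P (p : 'rV[R]_n * R) := 0 < p.2 /\ exists N,
  k2 * p.2 ^+ n < \sum_(J <= j < N | `|u j - p.1| <= 3 * p.2) d j `^ s.
have [e1 e10 He1] := exists_minorant (s := iota 0 J) (f := d) (fun j _ => d0 j).
have dense y : `|y - x| <= rho / 2 ->
    (forall j, hits x rho j -> 3 * d j <= `|y - u j|) ->
    exists t, P (y, t).
  move=> yx yfar.
  (* The three bounds make [r] admissible in [H], keep B(c, r) inside B(x, rho), and exclude the
     indices below [J], whose radii are at least [e1]. *)
  pose e2 := Num.min e (Num.min (rho / 4) (e1 / 2)).
  have e20 : 0 < e2 by rewrite !lt_min e0 !divr_gt0.
  have [c [r [t [Gcrt yc te2]]]] := G2 y e2 e20.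
  have [r0 rt tK] := G1 _ _ _ Gcrt.
  have : t <= e2 by []. rewrite !le_min => /and3P[te trho te1].
  have crho : `|c - x| + r <= rho.
    have := ler_distD y c x; rewrite (distrC c y); lra.
  have [N HN] := H _ _ _ Gcrt (le_trans rt te) crho.
  (* As B(u_j, d_j) meets B(c, r), 3 d_j <= |y - u_j| <= d_j + r + t <= d_j + 2t, whence d_j <=
     t. *)
  have hit j : hits c r j -> d j <= t /\ `|u j - y| <= 3 * t.
    rewrite /hits => cj.
    have xj : hits x rho j.
      rewrite /hits; have := ler_distD c (u j) x; lra.
    have := yfar _ xj; have := ler_distD c (u j) y.
    rewrite (distrC y (u j)) (distrC c y); lra.
  exists t; split=> /=; first exact: lt_le_trans rt.
  exists N; have kt : k2 * t ^+ n <= kappa `^ (s / n%:R) * r `^ s.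
    by rewrite /k2 -mulrA ler_wpM2l ?powR_ge0// ler_pdivrMl.
  apply: (le_lt_trans kt); apply: (lt_le_trans HN).
  have [JN|NJ] := leqP J N.
    rewrite (big_cat_nat (n := J))//= big1_seq ?add0r.
      rewrite big_mkcond [leRHS]big_mkcond/=; apply: ler_sum => j _.
      case: ifP => [/hit[_ ->]//|_]; case: ifP => // _; exact: powR_ge0.
    move=> j /andP[/hit[+ _]]; rewrite /index_iota subn0 => jt /He1; lra.
  rewrite big1_seq; first by apply: sumr_ge0 => j _; exact: powR_ge0.
  move=> j /andP[/hit[+ _]]; rewrite mem_index_iota => jt /andP[_ jN].
  have /He1 : j \in iota 0 J by rewrite mem_iota/= add0n (ltn_trans jN).
  lra.
pose I := (nat + 'rV[R]_n * R)%type.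
pose D : set I := [set i | match i with inl j => hits x rho j | inr p => P p end].
pose f (i : I) : set 'rV[R]_n := match i with
  inl j => ball (u j) (3 * d j) | inr p => ball p.1 p.2 end.
have [D' D'D cov] : finite_subset_cover D f [set y | `|y - x| <= rho / 2].
  have := @ball_compact x (rho / 2); rewrite compact_cover => /(_ I D f); apply.
    by move=> [j|p] _; exact: ball_open.
  move=> y /= yx.
  have [[j xj yj]|yfar] := pselect (exists2 j, hits x rho j & `|y - u j| < 3 * d j).
    by exists (inl j) => //=; rewrite -ball_normE /= distrC.
  have [|t Pt] := dense y yx.
    by move=> j xj; rewrite leNgt; apply/negP => yj; apply: yfar; exists j.
  by exists (inr (y, t)) => //=; apply: ballxx; case: Pt.
have D'P i : i \in D' -> D i by move=> /D'D /set_mem.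
pose g (i : I) := if i is inl j then j else 0%N.
pose N := (\max_(i <- D') g i).+1.
pose S2 := pmap (fun i : I => if i is inr p then Some p else None) D'.
have S2P p : (p \in S2) = (inr p \in D').
  rewrite mem_pmap; apply/mapP/idP => [[[j|q] qD' //= [->]]//|pD'].
  by exists (inr p).
have S20 p : p \in S2 -> P p by rewrite S2P => /D'P.
(* Separation by the factor 3 makes the balls of radius 3r disjoint, so no mass is counted twice.
   The enlargement by 7 suffices since r + 3(r + r') <= 7r' for r <= r'. *)
have [D2 [uD2 D2S2 D2sep D2cov]] :=
  @vitali_seq R n S2 3 (ltr0Sn _ _) (fun p pS => proj1 (S20 p pS)).
have D20 p : p \in D2 -> P p by move=> /D2S2/S20.
pose s1 := [seq (u j, 3 * d j) | j <- index_iota 0 N & hits x rho j].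
pose s2 := [seq (p.1, 7 * p.2) | p <- D2].
(* This volume bound is refuted: the two families contribute at most 1/2 and 1/4 of (rho/2)^n. *)
have := @cube_cover_volume R n x (rho / 2) (s1 ++ s2).
apply/not_implyP; split; first by rewrite divr_gt0.
apply/not_implyP; split.
  move=> p; rewrite mem_cat => /orP[/mapP[j _ ->]|/mapP[q qD2 ->]]/=.
    by rewrite mulr_gt0.
  by rewrite mulr_gt0//; case: (D20 _ qD2).
apply/not_implyP; split.
  move=> y yx; have [[j|p] /= iD'] := cov _ yx.
    rewrite -ball_normE /= distrC => /ltW yj; exists (u j, 3 * d j) => //.
    rewrite mem_cat; apply/orP; left; apply/mapP; exists j => //.
    rewrite mem_filter (D'P _ iD') mem_index_iota/= /N ltnS.
    exact: (leq_bigmax_seq (inl j : I) iD').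
  rewrite -ball_normE /= distrC => yp.
  have [|q qD2 [pq pq3]] := D2cov p; first by rewrite S2P.
  exists (q.1, 7 * q.2).
    by rewrite mem_cat; apply/orP; right; apply/mapP; exists q.
  by have := ler_distD p.1 y q.1; rewrite /=; lra.
apply/negP; rewrite -ltNge big_cat !big_map big_filter/=.
have -> : \sum_(0 <= j < N | hits x rho j) (4 * (3 * d j)) ^+ n
    = 12 ^+ n * \sum_(0 <= j < N | hits x rho j) d j ^+ n.
  rewrite mulr_sumr; apply: eq_bigr => j _.
  by rewrite mulrA exprMn; congr (_ ^+ _ * _); lra.
have -> : \sum_(p <- D2) (4 * (7 * p.2)) ^+ n = 28 ^+ n * \sum_(p <- D2) p.2 ^+ n.
  rewrite mulr_sumr; apply: eq_bigr => p _.
  by rewrite mulrA exprMn; congr (_ ^+ _ * _); lra.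
have D2sum : k2 * \sum_(p <- D2) p.2 ^+ n <= eps.
  pose Q (p : 'rV[R]_n * R) j := `|u j - p.1| <= 3 * p.2.
  have /choice[Nf HNf] : forall p, exists N, p \in D2 ->
      k2 * p.2 ^+ n <= \sum_(J <= j < N | Q p j) d j `^ s.
    move=> p; have [pD2|] := boolP (p \in D2); last by exists 0%N.
    by have [_ [N' /ltW HN']] := D20 _ pD2; exists N'.
  pose N3 := \max_(p <- D2) Nf p.
  apply: le_trans (HJ N3).
  apply: le_trans (@sum_disjoint_le R _ D2 Q _ J N3 uD2 _ _); last 2 first.
  - by move=> j; exact: powR_ge0.
  - move=> p q j pD2 qD2; rewrite /Q => pj qj; apply/eqP/negPn/negP => /(D2sep p q pD2 qD2).
    by have := ler_distD (u j) p.1 q.1; rewrite (distrC p.1 (u j)); lra.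
  rewrite mulr_sumr big_seq [leRHS]big_seq; apply: ler_sum => p pD2.
  apply: le_trans (HNf _ pD2) _; apply: ler_sum_nat_widen.
    by move=> j; exact: powR_ge0.
  exact: leq_bigmax_seq.
have := xsp N; rewrite -(ler_pM2l (_ : 0 < 12 ^+ n))// => xspN.
have {}D2sum : 28 ^+ n * \sum_(p <- D2) p.2 ^+ n <= kappa * rho ^+ n * 12 ^+ n / 2.
  by move: D2sum; rewrite /eps mulrC ler_pM2r// ler_pdivlMr// mulrC.
apply: le_lt_trans (lerD xspN D2sum) _.
have -> : 12 ^+ n * (kappa * rho ^+ n) = (rho / 2) ^+ n / 2.
  rewrite /kappa expr_div_n (_ : 24 = 12 * 2 :> R) ?(exprMn _ 12)//; last by lra.
  by field; rewrite !expf_neq0.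
have -> : kappa * rho ^+ n * 12 ^+ n / 2 = (rho / 2) ^+ n / 4.
  rewrite /kappa expr_div_n (_ : 24 = 12 * 2 :> R) ?(exprMn _ 12)//; last by lra.
  by field; rewrite !expf_neq0.
have : 0 < (rho / 2) ^+ n by rewrite exprn_gt0// divr_gt0.
lra.
Qed.

End shrinking.

(** By compactness the centres have a cluster point; each closed ball contains a tail of the
    centres, hence this point. *)
Lemma nested_balls_point (R : realType) m (c : nat -> 'rV[R]_m.+1) (r : nat -> R) :
  (forall k, 0 < r k) -> (forall k, `|c k.+1 - c k| + r k.+1 <= r k) ->
  exists x, forall k, `|x - c k| <= r k.
Proof.
move=> r0 step.
have nest k i : `|c (k + i)%N - c k| + r (k + i)%N <= r k.
  elim: i => [|i IH]; first by rewrite addn0 subrr normr0 add0r.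
  rewrite addnS; have := step (k + i)%N.
  have := ler_distD (c (k + i)%N) (c (k + i).+1) (c k); lra.
have inball k i : (k <= i)%N -> `|c i - c k| <= r k.
  by move=> /subnKC <-; have := nest k (i - k)%N; have := r0 (k + (i - k))%N; lra.
have [|x [_ xcl]] := @ball_compact R m (c 0%N) (r 0%N) (c @ \oo) _.
  by exists 0%N => // i _ /=; exact: inball.
exists x => k; rewrite leNgt; apply/negP => far.
have [||y [/= y1 y2]] := xcl [set y | `|y - c k| <= r k] (ball x (`|x - c k| - r k)).
- by exists k => // i /= ki; exact: inball.
- by apply: nbhsx_ballx; rewrite subr_gt0.
move: y2; rewrite -ball_normE/=.
by have := ler_distD y x (c k); lra.
Qed.

(** Iterating [shrink], with [G k] at stage [k], gives nested sparse balls with radii tending to 0.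
    A ball B(u_j, d_j) containing their common point would meet all of them, and sparsity would
    force d_j below every radius. *)
Lemma cover_escape (R : realType) m (s K M : R) (u : nat -> 'rV[R]_m.+1) (d : nat -> R)
    (G : nat -> set ('rV[R]_m.+1 * R * R)) x0 rho0 :
  0 < s -> s < m.+1%:R -> 0 < K -> (forall j, 0 < d j) ->
  (forall k, good_triples s K (G k)) ->
  (forall N, \sum_(0 <= j < N) d j `^ s <= M) ->
  0 < rho0 -> sparse u d x0 rho0 ->
  exists x, [/\ `|x - x0| <= rho0,
    forall k, exists c r t, G k (c, r, t) /\ `|x - c| <= r &
    forall j, d j < `|u j - x|].
Proof.
move=> s0 sm K0 d0 GG dM rho00 sp0.
pose valid (p : 'rV[R]_m.+1 * R) := 0 < p.2 /\ sparse u d p.1 p.2.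
have /choice[F HF] : forall kp : nat * ('rV[R]_m.+1 * R), exists q, valid kp.2 ->
    [/\ valid q, exists t, G kp.1 (q.1, q.2, t), q.2 <= kp.1.+1%:R^-1 &
        `|q.1 - kp.2.1| + q.2 <= kp.2.2].
  move=> [k p] /=; have [[p0 psp]|nv] := pselect (valid p); last by exists p.
  have k0 : 0 < k.+1%:R^-1 :> R by rewrite invr_gt0.
  have [c [r [Gt /andP[r0 rk] cr csp]]] := shrink s0 sm K0 d0 (GG k) dM p0 k0 psp.
  by exists (c, r).
pose B := fix B k := if k is k'.+1 then F (k', B k') else (x0, rho0).
have vB k : valid (B k) by elim: k => // k /(HF (k, B k))[].
have HB k := HF (k, B k) (vB k).
have [||x Hx] := @nested_balls_point R m (fun k => (B k).1) (fun k => (B k).2).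
- by move=> k; case: (vB k).
- by move=> k; case: (HB k).
exists x; split; first exact: (Hx 0%N).
  move=> k; have [_ [t Gt] _ _] := HB k.
  by exists (B k.+1).1, (B k.+1).2, t; split=> //; exact: (Hx k.+1).
move=> j; rewrite ltNge; apply/negP => ujx.
have dr k : d j <= (B k).2.
  have [r0 sp] := vB k.
  rewrite -(@ler_pXn2r R m.+1) ?nnegrE ?(ltW r0) ?(ltW (d0 j))//.
  have hj : hits u d (B k).1 (B k).2 j.
    by rewrite /hits; have := ler_distD x (u j) (B k).1; have := Hx k; lra.
  have : d j ^+ m.+1 <= \sum_(0 <= i < j.+1 | hits u d (B k).1 (B k).2 i) d i ^+ m.+1.
    rewrite big_mkcond big_nat_recr//= hj lerDr; apply: sumr_ge0 => i _.
    by case: ifP => // _; rewrite exprn_ge0// ltW.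
  move=> /le_trans/(_ (sp _)) /le_trans; apply.
  rewrite ler_piMl ?exprn_ge0 ?(ltW r0)//.
  rewrite /kappa invf_le1 ?mulr_gt0 ?exprn_gt0//.
  have : 1 <= 24 ^+ m.+1 :> R by rewrite exprn_ege1//; lra.
  lra.
pose k := Num.truncn (d j)^-1.
have := dr k.+1; have [_ _ Bk _] := HB k.
have : (d j)^-1 < k.+1%:R by exact: truncnS_gt.
rewrite invf_plt ?posrE// => h1 h2.
by have := le_lt_trans (le_trans h2 Bk) h1; rewrite ltxx.
Qed.

(** * Hausdorff measure *)

Section hausdorff_measure_theory.
Variables (R : realType) (T : normedModType R).
Implicit Types (A U V : set T) (s d : R).

Lemma diam_ge_dist U x y : U x -> U y -> (`|x - y|%:E <= diam U)%E.
Proof. by move=> Ux Uy; apply: ereal_sup_ubound; exists x => //; exists y. Qed.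

Lemma diam_ge0 U : U !=set0 -> (0 <= diam U)%E.
Proof. by move=> [x Ux]; have := diam_ge_dist Ux Ux; rewrite subrr normr0. Qed.

Lemma diam_pow_ge0 s U : (0 <= diam_pow s U)%E.
Proof. by rewrite /diam_pow; case: ifPn => // _; exact: poweR_ge0. Qed.

Lemma hausdorff_content_anti s d d' A : d' <= d ->
  (hausdorff_content s d A <= hausdorff_content s d' A)%E.
Proof.
move=> dd; apply: ereal_inf_le_tmp => _ [U [AU Ud] <-]; exists U => //.
by split=> // i; apply: le_trans (Ud i) _; rewrite lee_fin.
Qed.

Lemma hausdorff_content_le_measure s d A : 0 < d ->
  (hausdorff_content s d A <= hausdorff_measure s A)%E.
Proof. by move=> d0; apply: ereal_sup_ubound; exists d. Qed.

(** Powers of a number in (0, 1] decrease in the exponent; diameter 0 is treated apart because of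
    the convention 0^0 = 1. *)
Lemma diam_pow_anti s s' U : 0 <= s -> s <= s' -> (diam U <= 1)%E ->
  (diam_pow s' U <= diam_pow s U)%E.
Proof.
move=> s0 ss; rewrite /diam_pow; case: ifPn => // /set0P/diam_ge0.
case: (diam U) => [r| |]//; rewrite !lee_fin le_eqVlt => /predU1P[<-|r0] r1; last first.
  by rewrite ?poweR_EFin ?lee_fin ger_powR// r0.
rewrite ?poweR_EFin ?lee_fin.
have [->|s_n0] := eqVneq s 0; last first.
  by rewrite !powR0// gt_eqF// (lt_le_trans _ ss)// lt_neqAle eq_sym s_n0.
rewrite powRr0; have [->|s'_n0] := eqVneq s' 0; first by rewrite powRr0.
by rewrite powR0.
Qed.

(** Contents grow as the scale shrinks, so it suffices to compare them at scales at most 1. *)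
Lemma hausdorff_measure_anti s s' A : 0 <= s -> s <= s' ->
  (hausdorff_measure s' A <= hausdorff_measure s A)%E.
Proof.
move=> s0 ss; apply: ge_ereal_sup => _ [d d0 <-].
have d10 : 0 < Num.min d 1 by rewrite lt_min d0 /=.
apply: le_trans (hausdorff_content_le_measure s A d10).
apply: (@le_trans _ _ (hausdorff_content s' (Num.min d 1) A)).
  by apply: hausdorff_content_anti; rewrite ge_min lexx.
apply: le_ereal_inf_tmp => _ [U [AU Ud] <-]; apply: ge_ereal_inf.
exists (\sum_(0 <= i <oo) diam_pow s' (U i))%E; first by exists U.
apply: lee_nneseries => i _; first by move=> _; exact: diam_pow_ge0.
apply: diam_pow_anti => //; apply: le_trans (Ud i) _.
by rewrite lee_fin ge_min lexx orbT.
Qed.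

Lemma le_hausdorff_dim s A : 0 <= s -> hausdorff_measure s A = +oo%E ->
  (s%:E <= hausdorff_dim A)%E.
Proof.
move=> s0 sA; apply: le_ereal_inf_tmp => _ [s' [s'0 s'A] <-].
rewrite lee_fin leNgt; apply/negP => /ltW/(hausdorff_measure_anti A s'0).
by rewrite s'A sA.
Qed.

End hausdorff_measure_theory.

(** A cover is cut down to [A] before it is mapped. Contraction is asked on [A] only, so that the
    lemma also applies to the inverse of an isometry on its image. *)
Lemma hausdorff_measure_image_le (R : realType) (T T' : normedModType R)
    (f : T -> T') (A : set T) (s : R) : 0 <= s ->
  (forall x y, A x -> A y -> `|f x - f y| <= `|x - y|) ->
  (hausdorff_measure s (f @` A) <= hausdorff_measure s A)%E.
Proof.
move=> s0 fA; apply: ge_ereal_sup => _ [d d0 <-].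
apply: le_trans (hausdorff_content_le_measure s A d0).
apply: le_ereal_inf_tmp => _ [U [AU Ud] <-]; apply: ge_ereal_inf.
pose V i := f @` (U i `&` A).
have VU i : (diam (V i) <= diam (U i))%E.
  apply: ge_ereal_sup => _ [_ [x [Ux Ax] <-]] [_ [y [Uy Ay] <-] <-].
  by apply: le_trans (diam_ge_dist Ux Uy); rewrite lee_fin fA.
exists (\sum_(0 <= i <oo) diam_pow s (V i))%E.
  exists V => //; split; last by move=> i; exact: le_trans (VU i) (Ud i).
  by move=> _ [x Ax <-]; have [i _ Ux] := AU _ Ax; exists i => //; exists x.
apply: lee_nneseries => i _; first by move=> _; exact: diam_pow_ge0.
rewrite /diam_pow; case: ifPn => [_|V0]; first by case: ifPn => // _; exact: poweR_ge0.
have U0 : U i !=set0 by move: V0 => /set0P[_ [x [Ux _] _]]; exists x.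
rewrite ifF; last by apply/negbTE/set0P.
apply: gt0_ler_poweR => //; rewrite in_itv/= ?leey andbT diam_ge0//.
exact/set0P.
Qed.

Lemma hausdorff_measure_isometry (R : realType) (T T' : normedModType R)
    (f : T -> T') (g : T' -> T) (A : set T) (s : R) : 0 <= s ->
  (forall x y, `|f x - f y| = `|x - y|) -> cancel f g ->
  hausdorff_measure s (f @` A) = hausdorff_measure s A.
Proof.
move=> s0 ff fg; apply/eqP; rewrite eq_le hausdorff_measure_image_le//=; last first.
  by move=> x y _ _; rewrite ff.
have {1}-> : A = g @` (f @` A).
  apply/seteqP; split => [x Ax|_ [_ [x Ax <-] <-]]; last by rewrite fg.
  by exists (f x); [exists x|rewrite fg].
apply: hausdorff_measure_image_le => // _ _ [x _ <-] [y _ <-].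
by rewrite !fg ff.
Qed.

Lemma sum_geometric_half (R : realType) N :
  \sum_(0 <= j < N) 2^-1 ^+ j.+1 <= 1 :> R.
Proof.
suff -> : \sum_(0 <= j < N) 2^-1 ^+ j.+1 = 1 - 2^-1 ^+ N :> R.
  by rewrite gerBl exprn_ge0// invr_ge0.
elim: N => [|N IH]; first by rewrite big_geq// expr0 subrr.
rewrite big_nat_recr//= IH exprS; lra.
Qed.

Lemma powR_powRV (R : realType) (x s : R) : 0 < s -> 0 <= x -> (x `^ s^-1) `^ s = x.
Proof. by move=> s0 x0; rewrite -powRrM mulVf ?gt_eqF// powRr1. Qed.

Lemma powRV_powR (R : realType) (x s : R) : 0 < s -> 0 <= x -> (x `^ s) `^ s^-1 = x.
Proof. by move=> s0 x0; rewrite -powRrM mulfV ?gt_eqF// powRr1. Qed.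

(* A singleton has diameter 0, hence no cost: the radii are inflated so that they are
   positive. *)
Lemma hausdorff_measure_lt_pinfty_cover (R : realType) (T : normedModType R)
    (A : set T) (s : R) : 0 < s -> hausdorff_measure s A != +oo%E ->
  exists M, 0 < M /\ forall e, 0 < e <= 1 -> exists (u : nat -> T) (d : nat -> R),
    [/\ forall j, 0 < d j, forall j, d j `^ s <= e,
        forall N, \sum_(0 <= j < N) d j `^ s <= M &
        forall x, A x -> exists j, `|u j - x| <= d j].
Proof.
move=> s0 Hoo.
have [M0 [M00 HM]] : exists M, 0 <= M /\ forall d, 0 < d -> (hausdorff_content s d A <= M%:E)%E.
  have := @hausdorff_content_le_measure R T s _ A.
  case: (hausdorff_measure s A) Hoo => [r _ h|//|_ h].
    exists (Num.max 0 r); split; first by rewrite le_max lexx.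
    by move=> d /h/le_trans; apply; rewrite lee_fin le_max lexx orbT.
  by exists 0; split=> // d d0; apply: le_trans (h d d0) _; rewrite leNye.
(* One unit is for the gap between the infimum and a chosen cover, the other for the inflation of
   the radii. *)
exists (M0 + 2); split; first by lra.
(* Sets of diameter at most [dl] cost at most [e / 2]; the other half is left for the inflation. *)
move=> e /andP[e0 e1]; pose dl := (e / 2) `^ s^-1.
have e20 : 0 < e / 2 by rewrite divr_gt0.
have dl0 : 0 < dl by apply: powR_gt0.
have dls : dl `^ s = e / 2 by rewrite powR_powRV// ltW.
have : (hausdorff_content s dl A < (M0 + 1)%:E)%E.
  by apply: le_lt_trans (HM _ dl0) _; rewrite lte_fin; lra.
move=> /ereal_inf_lt[_ [U [AU Ud] <-] Usum].
have dpow j : (diam_pow s (U j) <= (e / 2)%:E)%E.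
  rewrite /diam_pow; case: ifPn => [_|/set0P/diam_ge0 U0]; first by rewrite lee_fin ltW.
  rewrite -dls -poweR_EFin; apply: gt0_ler_poweR; rewrite ?(ltW s0)//.
  - by rewrite in_itv/= leey U0.
  - by rewrite in_itv/= leey lee_fin ltW.
have dfin j : diam_pow s (U j) \is a fin_num.
  by rewrite ge0_fin_numE ?diam_pow_ge0// (le_lt_trans (dpow j)) ?ltry.
pose v j := fine (diam_pow s (U j)) + e / 2 * 2^-1 ^+ j.+1.
have g0 j : 0 < e / 2 * 2^-1 ^+ j.+1 by rewrite mulr_gt0// exprn_gt0// invr_gt0.
have v0 j : 0 < v j by apply: ltr_wpDl => //; apply: fine_ge0; exact: diam_pow_ge0.
pose d j := v j `^ s^-1.
have dE j : d j `^ s = v j by rewrite powR_powRV// ltW.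
(* A ball centred in [U j] with radius at least its diameter contains [U j]; the default centre 0
   concerns empty [U j] only. *)
exists (fun j => xget 0 (U j)), d; split.
- by move=> j; apply: powR_gt0.
- move=> j; rewrite dE /v.
  have : fine (diam_pow s (U j)) <= e / 2 by rewrite -lee_fin fineK.
  have : e / 2 * 2^-1 ^+ j.+1 <= e / 2.
    by rewrite ler_piMr ?(ltW e20)// exprn_ile1// ?invr_ge0// invf_le1// ler1n.
  lra.
- move=> N; under eq_bigr do rewrite dE.
  rewrite big_split/= -mulr_sumr.
  have : e / 2 * \sum_(0 <= j < N) 2^-1 ^+ j.+1 <= 1.
    by rewrite mulr_ile1 ?(ltW e20) ?sum_geometric_half//; [apply: sumr_ge0 => i _; rewrite exprn_ge0// invr_ge0|lra].
  have : \sum_(0 <= j < N) fine (diam_pow s (U j)) <= M0 + 1.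
    rewrite -lee_fin -sumEFin; under eq_bigr do rewrite fineK//.
    apply: le_trans (ltW Usum); apply: nneseries_lim_ge => j _ _; exact: diam_pow_ge0.
  lra.
- move=> x /AU[j _ Ujx]; exists j.
  have Ug : U j (xget 0 (U j)) by apply: xgetPex; exists x.
  rewrite -(powRV_powR s0 (normr_ge0 (xget 0 (U j) - x))) /d; apply: ge0_ler_powR.
  + by rewrite invr_ge0 ltW.
  + by rewrite nnegrE powR_ge0.
  + by rewrite nnegrE ltW.
  rewrite /v; apply: (@le_trans _ _ (fine (diam_pow s (U j)))); last by rewrite lerDl ltW.
  rewrite -lee_fin fineK//.
  rewrite /diam_pow ifF; last by apply/negbTE/set0P; exists x.
  rewrite -poweR_EFin; apply: gt0_ler_poweR; rewrite ?(ltW s0) ?in_itv/= ?leey ?lee_fin ?normr_ge0//.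
    by rewrite andbT; apply: diam_ge0; exists x.
  exact: diam_ge_dist.
Qed.

(** The unit cube is the ball with centre (1/2, ..., 1/2) and radius 1/2. If the measure were
    finite, there would be a cover with all d_j^s <= e and bounded sum; as d_j^n <= d_j^s e^p with p
    = (n - s)/s, a small [e] makes this ball sparse, and [cover_escape] yields an uncovered point of
    [E]. *)
Lemma hausdorff_measure_limsup (R : realType) m (s K : R)
    (G : nat -> set ('rV[R]_m.+1 * R * R)) (E : set 'rV[R]_m.+1) :
  0 < s -> s < m.+1%:R -> 0 < K -> (forall k, good_triples s K (G k)) ->
  (forall x, unit_cube m.+1 x ->
    (forall k, exists c r t, G k (c, r, t) /\ `|x - c| <= r) -> E x) ->
  hausdorff_measure s E = +oo%E.
Proof.
move=> s0 sm K0 GG GE; apply/eqP/negPn/negP => Hoo.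
have [M [M0 HM]] := hausdorff_measure_lt_pinfty_cover s0 Hoo.
pose n := m.+1; pose p := (n%:R - s) / s.
have p0 : 0 < p by rewrite divr_gt0// subr_gt0.
pose eta := kappa R m * 2^-1 ^+ n / M.
have eta0 : 0 < eta by rewrite divr_gt0// mulr_gt0 ?kappa_gt0// exprn_gt0// invr_gt0.
pose e := Num.min 1 (eta `^ p^-1).
have e01 : 0 < e <= 1 by rewrite ge_min lexx lt_min ltr01/= powR_gt0.
have [u [d [d0 de dM cov]]] := HM e e01.
have /andP[e0 e1] := e01.
have ep : e `^ p <= eta.
  rewrite -[leRHS](powR_powRV p0 (ltW eta0)); apply: ge0_ler_powR.
  - exact: ltW.
  - by rewrite nnegrE ltW.
  - by rewrite nnegrE powR_ge0.
  - by rewrite ge_min lexx orbT.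
have half0 : 0 < 2^-1 :> R by rewrite invr_gt0.
have sp : sparse u d (const_mx 2^-1) 2^-1.
  move=> N; apply: (@le_trans _ _ (\sum_(0 <= j < N) d j `^ s * eta)).
    rewrite big_mkcond; apply: ler_sum => j _; case: ifP => _; last first.
      by rewrite mulr_ge0 ?powR_ge0// ltW.
    rewrite -(@powR_mulrn R (d j) n) ?(ltW (d0 j))//.
    have -> : n%:R = s + s * p by rewrite /p mulrC divfK ?gt_eqF// addrC subrK.
    rewrite powRD; last by rewrite (gt_eqF (d0 j)) implybT.
    rewrite ler_wpM2l ?powR_ge0// powRrM; apply: le_trans ep.
    by apply: ge0_ler_powR; rewrite ?nnegrE ?powR_ge0 ?(ltW p0) ?(ltW e0).
  rewrite -mulr_suml; apply: (@le_trans _ _ (M * eta)); first by rewrite ler_wpM2r// ltW.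
  by rewrite /eta mulrC divfK ?gt_eqF.
have [x [xcube xG xfar]] := cover_escape s0 sm K0 d0 GG dM half0 sp.
have /cov[j] : E x.
  apply: GE => // j; move/rV_norm_leP: xcube => /(_ (ltW half0) j).
  by rewrite !mxE ler_norml; lra.
by rewrite leNgt xfar.
Qed.

(** * Simultaneous approximation *)

Lemma nint_dist_le (R : realType) k (x : 'rV[R]_k) (p : 'rV[int]_k) :
  nint_dist x <= `|x - map_mx intr p|.
Proof. by have [z -> Hz] := nint_dist_attained x. Qed.

(** Pigeonhole: the fractional parts of [q *: x] for the [N + 1] values q = 0, ..., N fall into at
    most [N] boxes with sides [1 / a i]. Two values sharing a box have the required [q] as
    difference. *)
Lemma dirichlet_box (R : realType) k (x : 'rV[R]_k) (a : 'I_k -> nat) N :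
  (forall i, (0 < a i)%N) -> (\prod_i a i <= N)%N ->
  exists q : nat, (0 < q <= N)%N /\ exists p : 'rV[int]_k,
    forall i, `|q%:R * x ord0 i - (p ord0 i)%:~R| < (a i)%:R^-1.
Proof.
move=> a0 aN.
pose y (q : nat) i := q%:R * x ord0 i - (Num.floor (q%:R * x ord0 i))%:~R.
have y01 q i : 0 <= y q i < 1.
  rewrite /y subr_ge0 floor_le/= ltrBlDr addrC -[1]/(1%:~R) -intrD.
  exact: floorD1_gt.
have cell_lt q i : (Num.truncn ((a i)%:R * y q i) < a i)%N.
  have /andP[y0 y1] := y01 q i.
  by rewrite truncn_lt_nat ?mulr_ge0// gtr_pMr// ltr0n.
pose cell (q : 'I_N.+1) : {dffun forall i, 'I_(a i)} :=
  [ffun i => Ordinal (cell_lt q i)].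
have : ~ injective cell.
  move=> /leq_card; rewrite card_ord card_dep_ffun foldrE big_map big_enum/=.
  under eq_bigr do rewrite card_ord.
  by rewrite leqNgt ltnS aN.
have main (q1 q2 : 'I_N.+1) : (q1 < q2)%N -> cell q1 = cell q2 ->
    exists q : nat, (0 < q <= N)%N /\ exists p : 'rV[int]_k,
    forall i, `|q%:R * x ord0 i - (p ord0 i)%:~R| < (a i)%:R^-1.
  move=> q12 c12; exists (q2 - q1)%N; split.
    by rewrite subn_gt0 q12 (leq_trans (leq_subr _ _))// -ltnS.
  exists (\row_i (Num.floor (q2%:R * x ord0 i) - Num.floor (q1%:R * x ord0 i))) => i.
  rewrite mxE intrB natrB ?(ltnW q12)//.
  have -> : (q2%:R - q1%:R) * x ord0 i - ((Num.floor (q2%:R * x ord0 i))%:~R -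
      (Num.floor (q1%:R * x ord0 i))%:~R) = y q2 i - y q1 i by rewrite /y; ring.
  have ai : 0 < (a i)%:R :> R by rewrite ltr0n.
  have /andP[l1 u1] := y01 q1 i; have /andP[l2 u2] := y01 q2 i.
  have ec : Num.truncn ((a i)%:R * y q1 i) = Num.truncn ((a i)%:R * y q2 i).
    have := congr1 (fun f : {dffun forall i, 'I_(a i)} => nat_of_ord (f i)) c12.
    by rewrite !ffunE.
  have /andP[] := truncn_itv (mulr_ge0 (ltW ai) l1).
  have /andP[] := truncn_itv (mulr_ge0 (ltW ai) l2).
  rewrite ec -natr1 => h1 h2 h3 h4.
  rewrite -(ltr_pM2l ai) divff ?gt_eqF// -[X in X * _](gtr0_norm ai) -normrM.
  by rewrite ltr_norml mulrBr; lra.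
move=> noinj; apply: contrapT => H; apply: noinj => q1 q2 c12.
apply: val_inj; case: (ltngtP q1 q2) => // q12; exfalso; apply: H.
  exact: main q12 c12.
exact: main q12 (esym c12).
Qed.

(* Either some [q *: x] is integral, and its multiples do, or the [q] produced for
   large [N] cannot stay bounded. *)
Lemma dirichlet_infinite (R : realType) k (x : 'rV[R]_k) (e C : 'I_k -> R) :
  (forall i, 0 < e i) -> (forall i, 0 < C i) ->
  (forall N0, exists N : nat, (N0 <= N)%N /\ exists q : nat, (0 < q <= N)%N /\
    exists p : 'rV[int]_k,
      forall i, `|q%:R * x ord0 i - (p ord0 i)%:~R| < C i * N%:R `^ (- e i)) ->
  forall n, exists q : nat, [/\ (n <= q)%N, (0 < q)%N & exists p : 'rV[int]_k,
    forall i, `|q%:R * x ord0 i - (p ord0 i)%:~R| < C i * q%:R `^ (- e i)].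
Proof.
move=> e0 C0 H n.
have [[q0 q00 [p0 Hp0]]|irr] := pselect (exists2 q0 : nat, (0 < q0)%N &
    exists p : 'rV[int]_k, forall i, q0%:R * x ord0 i = (p ord0 i)%:~R).
  exists (n.+1 * q0)%N; split.
  - by rewrite (leq_trans (leqnSn n))// leq_pmulr.
  - by rewrite muln_gt0.
  - exists (n.+1%:Z *: p0) => i.
    rewrite mxE natrM intrM -mulrA Hp0 subrr normr0 mulr_gt0// powR_gt0//.
    by rewrite mulr_gt0 ?ltr0n.
have dpos q : q \in iota 1 n -> 0 < nint_dist (q%:R *: x).
  rewrite mem_iota => /andP[q1 _].
  have [z -> _] := nint_dist_attained (q%:R *: x).
  rewrite normr_gt0 subr_eq0; apply/eqP => E; apply: irr.
  exists q => //; exists z => i; move/matrixP: E => /(_ ord0 i).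
  by rewrite !mxE.
have [d d0 Hd] := exists_minorant dpos.
(* For [N >= N0] the error is at most [d / 2] in every coordinate, which no [q <= n] achieves. The
   sum over [i] merely dominates each term. *)
pose N0 := (\sum_i (Num.truncn ((C i * (2 / d)) `^ (e i)^-1)).+1).+1%N.
have [N [N0N [q [/andP[q0 qN] [p Hp]]]]] := H N0.
have NR : 0 < N%:R :> R by rewrite ltr0n (leq_trans _ N0N).
exists q; split=> //; last first.
  exists p => i; apply: lt_le_trans (Hp i) _.
  rewrite ler_pM2l// !powRN lef_pV2 ?posrE ?powR_gt0//; last by rewrite ltr0n.
  by apply: ge0_ler_powR; rewrite ?nnegrE ?ler0n ?ler_nat// ltW.
rewrite leqNgt; apply/negP => qn.
have qio : q \in iota 1 n by rewrite mem_iota q0 /= add1n ltnS; exact: (ltnW qn).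
have := le_trans (Hd _ qio) (nint_dist_le _ p).
apply/negP; rewrite -ltNge; apply: (@le_lt_trans _ _ (d / 2)); last by lra.
apply/rV_norm_leP => [|i]; first by rewrite divr_ge0// ltW.
rewrite !mxE; apply: le_trans (ltW (Hp i)) _.
have Ne : C i * (2 / d) <= N%:R `^ e i.
  have X0 : 0 < C i * (2 / d) by rewrite mulr_gt0// divr_gt0.
  have -> : C i * (2 / d) = ((C i * (2 / d)) `^ (e i)^-1) `^ e i.
    by rewrite -powRrM mulVf ?gt_eqF// powRr1// ltW.
  apply: ge0_ler_powR; rewrite ?nnegrE ?powR_ge0 ?ler0n ?(ltW (e0 i))//.
  apply: le_trans (ltW (truncnS_gt _)) _; rewrite ler_nat.
  apply: leq_trans N0N; apply: leqW.
  by rewrite (bigD1 i)//= leq_addr.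
rewrite powRN ler_pdivrMr ?powR_gt0//.
rewrite -ler_pdivrMl ?divr_gt0//; apply: le_trans Ne.
by rewrite invf_div mulrC.
Qed.

Lemma nint_dist_ltP (R : realType) k (x : 'rV[R]_k) (c : R) : 0 < c ->
  nint_dist x < c <->
  exists p : 'rV[int]_k, forall i, `|x ord0 i - (p ord0 i)%:~R| < c.
Proof.
move=> c0; split=> [|[p Hp]].
  have [p -> _] := nint_dist_attained x => pc; exists p => i.
  by apply: le_lt_trans pc; have := rV_coord_le_norm (x - map_mx intr p) i; rewrite !mxE.
apply: le_lt_trans (nint_dist_le x p) _.
rewrite /Num.norm/= mx_normrE; apply/bigmax_ltP; split=> // -[i j] _ /=.
by rewrite !mxE ord1.
Qed.

Lemma powR_ge1 (R : realType) (a x : R) : 1 <= a -> 0 <= x -> 1 <= a `^ x.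
Proof. by move=> a1 x0; rewrite -(powRr0 a) ler_powR. Qed.

Lemma row_mx_ord (R : Type) l m (x : 'rV[R]_l) (y : 'rV[R]_m) i :
  row_mx x y ord0 i = match fintype.split i with inl j => x ord0 j | inr j => y ord0 j end.
Proof. by rewrite mxE. Qed.

(** Taking for [N] perfect k-th powers makes N^(1/k) an integer, so that no constant is lost. *)
Lemma dirichlet_uniform (R : realType) k (x : 'rV[R]_k) : (0 < k)%N ->
  forall n, exists q : nat, [/\ (n <= q)%N, (0 < q)%N &
    nint_dist (q%:R *: x) < q%:R `^ (- k%:R^-1)].
Proof.
move=> k0 n; have kR : 0 < k%:R :> R by rewrite ltr0n.
have [||N0|q [nq q0 [p Hp]]] :=
  @dirichlet_infinite R k x (fun=> k%:R^-1) (fun=> 1) _ _ _ n.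
- by move=> _; rewrite invr_gt0.
- by [].
- exists (N0.+1 ^ k)%N; split.
    by rewrite (leq_trans (leqnSn N0))// -[leqLHS]expn1 leq_pexp2l.
  have [||q [qN [p Hp]]] := @dirichlet_box R k x (fun=> N0.+1) (N0.+1 ^ k).
  + by [].
  + by rewrite prod_nat_const card_ord.
  exists q; split=> //; exists p => i.
  rewrite mul1r powRN natrX -powR_mulrn// -powRrM divff ?gt_eqF// powRr1//.
exists q; split=> //; apply/nint_dist_ltP; first by rewrite powR_gt0// ltr0n.
by exists p => i; rewrite mxE; have := Hp i; rewrite mul1r.
Qed.

(** With more than N^tau cells in each coordinate of [x] the constant there is 1; each coordinate of
    [y] gets [b] cells, where a^l b^m <= N. The losses go into [C]: (2^l)^(1/m) from rounding N^tau
    up to [a], and 2 from rounding [B] down to [b]. *)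
Lemma dirichlet_weighted (R : realType) l m (x : 'rV[R]_l) (y : 'rV[R]_m) (tau : R) :
  (0 < m)%N -> 0 < tau -> l%:R * tau < 1 ->
  let C := 2 * (2 ^+ l) `^ m%:R^-1 in
  let sigma := (1 - l%:R * tau) / m%:R in
  forall n, exists q : nat, [/\ (n <= q)%N, (0 < q)%N,
    nint_dist (q%:R *: x) < q%:R `^ (- tau) &
    exists p : 'rV[int]_m, forall j,
      `|q%:R * y ord0 j - (p ord0 j)%:~R| <= C * q%:R `^ (- sigma)].
Proof.
move=> m0 tau0 ltau C sigma n.
have mR : 0 < m%:R :> R by rewrite ltr0n.
have sigma0 : 0 < sigma by rewrite divr_gt0// subr_gt0.
have C0 : 0 < C by rewrite mulr_gt0// powR_gt0// exprn_gt0.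
pose e (i : 'I_(l + m)) := if fintype.split i is inl _ then tau else sigma.
pose D (i : 'I_(l + m)) := if fintype.split i is inl _ then 1 else C.
have [||N0|q [nq q0 [p Hp]]] := @dirichlet_infinite R (l + m) (row_mx x y) e D _ _ _ n.
- by move=> i; rewrite /e; case: fintype.split.
- by move=> i; rewrite /D; case: fintype.split.
(* [N1] ensures N^(1 - l tau) >= 2^l, from which [B >= 1] and [b > 0] follow. *)
- pose N1 := Num.truncn ((2 ^+ l) `^ (1 - l%:R * tau)^-1 : R).
  pose N := (N0 + N1).+1; exists N; split; first by rewrite leqW// leq_addr.
  have NR : 0 < N%:R :> R by rewrite ltr0n.
  have N1R : 1 <= N%:R :> R by rewrite ler1n.
  have lt0 : 0 < 1 - l%:R * tau by rewrite subr_gt0.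
  have Nbig : 2 ^+ l <= N%:R `^ (1 - l%:R * tau).
    rewrite -[leLHS](powR_powRV lt0) ?exprn_ge0//.
    apply: ge0_ler_powR; rewrite ?nnegrE ?powR_ge0 ?(ltW lt0)//.
    apply: le_trans (ltW (truncnS_gt _)) _.
    by rewrite ler_nat ltnS leq_addl.
  pose a := (Num.truncn (N%:R `^ tau)).+1.
  have aR : 0 < a%:R :> R by rewrite ltr0n.
  have a_gt : N%:R `^ tau < a%:R by exact: truncnS_gt.
  have a_le : a%:R <= 2 * N%:R `^ tau.
    have : 1 <= N%:R `^ tau by rewrite powR_ge1// ltW.
    have : (Num.truncn (N%:R `^ tau))%:R <= N%:R `^ tau by rewrite truncn_le powR_ge0.
    by rewrite /a -natr1; lra.
  have al_le : a%:R ^+ l <= 2 ^+ l * N%:R `^ (l%:R * tau).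
    rewrite mulrC powRrM (powRAC _ l%:R) powR_mulrn ?powR_ge0// -exprMn mulrC.
    by rewrite lerXn2r ?nnegrE ?mulr_ge0 ?powR_ge0// ltW.
  pose B : R := (N%:R / a%:R ^+ l) `^ m%:R^-1.
  have al0 : 0 < a%:R ^+ l :> R by rewrite exprn_gt0.
  have Nal0 : 0 < N%:R / a%:R ^+ l :> R by rewrite divr_gt0.
  have BC : 2 <= B * (C * N%:R `^ (- sigma)).
    have -> : C * N%:R `^ (- sigma) = 2 * (2 ^+ l * N%:R `^ (l%:R * tau - 1)) `^ m%:R^-1.
      rewrite powRM ?exprn_ge0 ?powR_ge0// /C -mulrA; congr (_ * (_ * _)).
      by rewrite -powRrM /sigma -mulNr opprB.
    rewrite mulrCA ler_peMr// /B -powRM ?mulr_ge0 ?powR_ge0 ?exprn_ge0 ?(ltW Nal0)//.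
    apply: powR_ge1; last by rewrite invr_ge0 ltW.
    have -> : N%:R / a%:R ^+ l * (2 ^+ l * N%:R `^ (l%:R * tau - 1)) =
        (2 ^+ l * N%:R `^ (l%:R * tau)) / a%:R ^+ l.
      rewrite powRB; last by rewrite (gt_eqF NR) implybT.
      by rewrite powRr1 ?ler0n//; field; rewrite !gt_eqF.
    by rewrite ler_pdivlMr// mul1r.
  have B1 : 1 <= B.
    apply: powR_ge1; last by rewrite invr_ge0 ltW.
    rewrite ler_pdivlMr// mul1r; apply: (le_trans al_le).
    apply: (@le_trans _ _ (N%:R `^ (1 - l%:R * tau) * N%:R `^ (l%:R * tau))).
      by rewrite ler_wpM2r// powR_ge0.
    by rewrite -powRD ?subrK ?powRr1 ?ler0n// (gt_eqF NR) implybT.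
  pose b := Num.truncn B.
  have b0 : (0 < b)%N by rewrite truncn_gt0.
  have bR : 0 < b%:R :> R by rewrite ltr0n.
  have b_le : b%:R <= B by rewrite truncn_le (le_trans ler01).
  have b_gt : B < 2 * b%:R.
    have : B < b.+1%:R by exact: truncnS_gt.
    have : 1 <= b%:R :> R by rewrite ler1n.
    by rewrite -natr1; lra.
  have [||q [qN [p Hp]]] := @dirichlet_box R (l + m) (row_mx x y)
      (fun i => if fintype.split i is inl _ then a else b) N.
  + by move=> i; case: fintype.split.
  + rewrite big_split_ord/=.
    under eq_bigr do rewrite (unsplitK (inl _)).
    under [X in (_ * X)%N]eq_bigr do rewrite (unsplitK (inr _)).
    rewrite !prod_nat_const !card_ord -(ler_nat R) natrM !natrX.
    rewrite -ler_pdivlMl// mulrC; apply: (@le_trans _ _ (B ^+ m)).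
      by rewrite lerXn2r ?nnegrE ?(ltW bR) ?(le_trans ler01).
    by rewrite -powR_mulrn ?powR_ge0// powR_powRV// ?(ltW Nal0)// -powRrM mulVf ?gt_eqF// powRr1// ltW.
  exists q; split=> //; exists p => i; apply: lt_le_trans (Hp i) _.
  rewrite /D /e; case: fintype.split => _.
    rewrite mul1r powRN lef_pV2 ?posrE ?powR_gt0//; exact: ltW.
  rewrite -(ler_pM2l bR) divff ?gt_eqF//.
  have : 0 <= C * N%:R `^ (- sigma) by rewrite mulr_ge0 ?powR_ge0// ltW.
  by nra.
exists q; split=> //.
  apply/nint_dist_ltP; first by rewrite powR_gt0// ltr0n.
  exists (lsubmx p) => i; have := Hp (lshift m i).
  rewrite /D /e row_mx_ord (unsplitK (inl i)) mul1r.
  by rewrite !mxE.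
exists (rsubmx p) => j; have := Hp (rshift l j).
rewrite /D /e row_mx_ord (unsplitK (inr j)) !mxE; exact: ltW.
Qed.

(** * The fibre *)

Lemma infinite_set_natP (A : set nat) :
  infinite_set A <-> forall n, exists2 q, (n <= q)%N & A q.
Proof.
split=> [Ainf n|H /finite_seqP[s As]].
  apply: contrapT => noq; apply: Ainf; apply: sub_finite_set (finite_II n) => q Aq /=.
  by rewrite ltnNge; apply/negP => nq; apply: noq; exists q.
have [q + Aq] := H (\max_(x <- s) x).+1.
move: Aq; rewrite As /= ltnNge => qs /negP; apply.
exact: (leq_bigmax_seq q).
Qed.

Lemma row_mx_isometry (R : realType) l m (x : 'rV[R]_l) (y z : 'rV[R]_m) :
  `|row_mx x y - row_mx x z| = `|y - z|.
Proof.
apply/eqP; rewrite eq_le; apply/andP; split; apply/rV_norm_leP => // i.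
  rewrite !mxE; case: fintype.split => j; first by rewrite subrr normr0.
  by have := rV_coord_le_norm (y - z) j; rewrite !mxE.
have := rV_coord_le_norm (row_mx x y - row_mx x z) (rshift l i).
by rewrite !mxE (unsplitK (inr i)).
Qed.

Lemma unit_cube_row_mx (R : realType) l m (x : 'rV[R]_l) (y : 'rV[R]_m) :
  unit_cube l x -> unit_cube m y -> unit_cube (l + m) (row_mx x y).
Proof. by move=> hx hy i; rewrite mxE; case: fintype.split. Qed.

(* Apply the limsup lemma to the family of all small balls. *)
Lemma hausdorff_measure_cube (R : realType) m (s : R) : 0 < s -> s < m.+1%:R ->
  hausdorff_measure s (@unit_cube R m.+1) = +oo%E.
Proof.
move=> s0 sm.
pose G (k : nat) : set ('rV[R]_m.+1 * R * R) :=
  [set crt | 0 < crt.1.2 <= 1 /\ crt.2 = crt.1.2].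
apply: (@hausdorff_measure_limsup R m s 1 G) => // k; split=> [c r t|y e e0].
  move=> [/= r01 ->]; have /andP[r0 r1] := r01; split=> //.
  by rewrite mul1r -powR_mulrn ?(ltW r0)// ger_powR// ltW.
exists y, (Num.min e 1), (Num.min e 1).
have r0 : 0 < Num.min e 1 by rewrite lt_min e0 ltr01.
by split; rewrite ?subrr ?normr0 ?ge_min ?lexx ?(ltW r0)//=; split=> //=; rewrite r0 ge_min lexx orbT.
Qed.

(** The limsup lemma is applied with c = p/q, r = q^(-1-tau)/2 and t = C q^(-1-sigma). The relation
    between [s], [tau] and [sigma] gives t^n = C^n 2^s r^s for n = [m.+1], whence the constant
    [K]. *)
Lemma hausdorff_measure_fiber (R : realType) l m (tau sigma C s : R) (alpha : 'rV[R]_l) :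
  unit_cube l alpha -> 0 <= sigma -> sigma <= tau -> 1 <= C ->
  0 < s -> s < m.+1%:R -> s * (1 + tau) = m.+1%:R * (1 + sigma) ->
  (forall (y : 'rV[R]_m.+1) n, exists q : nat, [/\ (n <= q)%N, (0 < q)%N,
    nint_dist (q%:R *: alpha) < q%:R `^ (- tau) &
    exists p : 'rV[int]_m.+1, forall j,
      `|q%:R * y ord0 j - (p ord0 j)%:~R| <= C * q%:R `^ (- sigma)]) ->
  hausdorff_measure s
    [set y | unit_cube m.+1 y /\ W (l + m.+1) tau (row_mx alpha y)] = +oo%E.
Proof.
move=> acube sigma0 sigtau C1 s0 sm sE approx.
have C0 : 0 < C by lra.
pose G (k : nat) : set ('rV[R]_m.+1 * R * R) := [set crt |
  exists (q : nat) (p : 'rV[int]_m.+1), [/\ (k <= q)%N, (0 < q)%N,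
    nint_dist (q%:R *: alpha) < q%:R `^ (- tau) &
    crt = (q%:R^-1 *: map_mx intr p, q%:R `^ (- (1 + tau)) / 2,
           C * q%:R `^ (- (1 + sigma)))]].
have K0 : 0 < C ^+ m.+1 * 2 `^ s by rewrite mulr_gt0 ?exprn_gt0 ?powR_gt0.
have splitpow (q : nat) (x : R) : (0 < q)%N -> q%:R `^ (- (1 + x)) = q%:R^-1 * q%:R `^ (- x) :> R.
  move=> q0; have qR : 0 < q%:R :> R by rewrite ltr0n.
  by rewrite opprD powRD ?(gt_eqF qR) ?implybT// powR_inv1// ltW.
apply: (@hausdorff_measure_limsup R m s (C ^+ m.+1 * 2 `^ s) G) => //.
  move=> k; split=> [c r t|y e e0].
    move=> [q [p [_ q0 _ [_ -> ->]]]].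
    have qR : 0 < q%:R :> R by rewrite ltr0n.
    have q1 : 1 <= q%:R :> R by rewrite ler1n.
    split; first by rewrite divr_gt0// powR_gt0.
      have : q%:R `^ (- (1 + tau)) <= q%:R `^ (- (1 + sigma)).
        by apply: ler_powR => //; lra.
      have : 0 < q%:R `^ (- (1 + tau)) by rewrite powR_gt0.
      nra.
    rewrite exprMn -mulrA ler_wpM2l ?exprn_ge0 ?(ltW C0)//.
    rewrite -powRM ?divr_ge0 ?powR_ge0// mulrC divfK//.
    rewrite -powR_mulrn ?powR_ge0// -!powRrM.
    by rewrite mulNr mulrC -sE mulrC mulNr.
  have [q [kq q0 qa [p Hp]]] := approx y (maxn k (Num.truncn (C / e)).+1).
  have qR : 0 < q%:R :> R by rewrite ltr0n.
  have q1 : 1 <= q%:R :> R by rewrite ler1n.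
  move: kq; rewrite geq_max => /andP[kq eq].
  exists (q%:R^-1 *: map_mx intr p), (q%:R `^ (- (1 + tau)) / 2),
    (C * q%:R `^ (- (1 + sigma))); split; first by exists q, p.
    apply/rV_norm_leP => [|j]; first by rewrite mulr_ge0 ?powR_ge0// ltW.
    rewrite !mxE splitpow// mulrCA -(ler_pM2l qR) mulVKf ?gt_eqF//.
    rewrite -[X in X * _](gtr0_norm qR) -normrM mulrBr mulVKf ?gt_eqF//.
  have Cq : C / q%:R <= e.
    rewrite ler_pdivrMr// mulrC -ler_pdivrMr//.
    by apply: le_trans (ltW (truncnS_gt _)) _; rewrite ler_nat.
  apply: le_trans Cq; rewrite ler_wpM2l ?(ltW C0)// -powR_inv1 ?(ltW qR)//.
  by apply: ler_powR => //; lra.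
move=> x xcube xG; split=> //; split; first exact: unit_cube_row_mx.
apply/infinite_set_natP => n.
have [c [r [t [[q [p [nq q0 qa [-> -> _]]]] xc]]]] := xG n.
have qR : 0 < q%:R :> R by rewrite ltr0n.
have qt0 : 0 < q%:R `^ (- tau) :> R by rewrite powR_gt0.
exists q => //; split=> //; apply/nint_dist_ltP => //.
have /(nint_dist_ltP _ qt0)[z Hz] := qa.
exists (row_mx z p) => i; rewrite !mxE; case: fintype.split => j.
  by have := Hz j; rewrite mxE.
move: xc; rewrite splitpow// => xc.
have {}xc : `|x ord0 j - q%:R^-1 * (p ord0 j)%:~R| <= q%:R^-1 * q%:R `^ (- tau) / 2.
  apply: le_trans xc; have := rV_coord_le_norm (x - q%:R^-1 *: map_mx intr p) j.
  by rewrite !mxE.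
(* The factor 1/2 in the radius gives the strict inequality although the balls are closed. *)
apply: (@le_lt_trans _ _ (q%:R `^ (- tau) / 2)); last by lra.
move: xc; rewrite -(ler_pM2l qR) -mulrA mulVKf ?gt_eqF//.
by rewrite -[X in X * _](gtr0_norm qR) -normrM mulrBr mulVKf ?gt_eqF.
Qed.

Lemma fiber_W (R : realType) l m (tau : R) (alpha : 'rV[R]_l) :
  fiber m alpha `&` W (l + m) tau =
  row_mx alpha @` [set y | unit_cube m y /\ W (l + m) tau (row_mx alpha y)].
Proof.
apply/seteqP; split => [_ [[y ycube <-] Wy]|_ [y [ycube Wy] <-]]; first by exists y.
by split=> //; exists y.
Qed.

Lemma hausdorff_measure_row_mx (R : realType) l m (alpha : 'rV[R]_l) (A : set 'rV[R]_m) s :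
  0 <= s -> hausdorff_measure s (row_mx alpha @` A) = hausdorff_measure s A.
Proof.
move=> s0; apply: (@hausdorff_measure_isometry _ _ _ _ (@rsubmx R 1 l m)) => //.
  exact: row_mx_isometry.
exact: row_mxKr.
Qed.

Lemma W_dirichlet (R : realType) k (tau : R) : (0 < k)%N -> tau <= k%:R^-1 ->
  W k tau = unit_cube k.
Proof.
move=> k0 tauk; apply/seteqP; split=> [x []//|x xcube]; split=> //.
apply/infinite_set_natP => n.
have [q [nq q0 qx]] := dirichlet_uniform x k0 n.
exists q => //; split=> //; apply: lt_le_trans qx _.
by apply: ler_powR; [rewrite ler1n|lra].
Qed.

(** The measure is infinite at every positive exponent below [m.+1]. Were the dimension smaller than
    [m.+1], the midpoint of the two would contradict this. *)
Lemma hausdorff_dim_cube (R : realType) l m (alpha : 'rV[R]_l) :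
  (m.+1%:R%:E <= hausdorff_dim (row_mx alpha @` @unit_cube R m.+1))%E.
Proof.
set A := row_mx alpha @` _.
have H s : 0 < s -> s < m.+1%:R -> (s%:E <= hausdorff_dim A)%E.
  move=> s0 sm; apply: le_hausdorff_dim; first exact: ltW.
  by rewrite hausdorff_measure_row_mx ?ltW// hausdorff_measure_cube.
have d0 : (0 <= hausdorff_dim A)%E.
  by apply: le_ereal_inf_tmp => _ [s [s0 _] <-]; rewrite lee_fin.
have m0 : 0 < m.+1%:R :> R by rewrite ltr0n.
rewrite leNgt; apply/negP; case: (hausdorff_dim A) H d0 => [r| |]//= H.
rewrite lee_fin lte_fin => r0 rm.
have : (r + m.+1%:R) / 2 <= r by rewrite -lee_fin; apply: H; lra.
lra.
Qed.

Theorem theorem3p4 (R : realType) (l m : nat) (tau : R) (alpha : 'rV[R]_l)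
    (l_gt0 : (0 < l)%N) (m_gt0 : (0 < m)%N) (tau_gt0 : 0 < tau)
    (alphaW : W l tau alpha) :
  ((s_lower l m tau)%:E
     <= hausdorff_dim (fiber m alpha `&` W (l + m) tau))%E /\
  hausdorff_measure (s_lower l m tau) (fiber m alpha `&` W (l + m) tau)
    = hausdorff_measure (s_lower l m tau) (unit_cube m : set 'rV[R]_m).
Proof.
have [acube ainf] := alphaW.
case: m m_gt0 => // m _; rewrite fiber_W.
have lR : 0 < l%:R :> R by rewrite ltr0n.
have mR : 0 < m.+1%:R :> R by rewrite ltr0n.
set n := (l + m.+1)%N; set E := [set y | _].
have nE : n%:R = l%:R + m.+1%:R :> R by rewrite natrD.
have nR : 0 < n%:R :> R by rewrite nE addr_gt0.
have [taun|ntau] := leP tau n%:R^-1.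
  have -> : E = unit_cube m.+1.
    apply/seteqP; split=> [y []//|y ycube]; split=> //.
    rewrite W_dirichlet//; first exact: unit_cube_row_mx.
    by rewrite /n addnS.
  rewrite /s_lower -/n taun; split; first exact: hausdorff_dim_cube.
  by rewrite hausdorff_measure_row_mx.
(* Since [s] is below the dimension of the cube, the cube has infinite measure as well. *)
suff [s0 sm sE] : [/\ 0 < s_lower l m.+1 tau, s_lower l m.+1 tau < m.+1%:R &
    hausdorff_measure (s_lower l m.+1 tau) E = +oo%E].
  split.
    by apply: le_hausdorff_dim; rewrite ?hausdorff_measure_row_mx ?ltW.
  by rewrite hausdorff_measure_row_mx ?(ltW s0)// sE hausdorff_measure_cube.
(* When l tau < 1, this inequality yields both [s < m.+1] and sigma <= tau. *)
have nt : 1 < n%:R * tau by rewrite mulrC -ltr_pdivrMr// mul1r.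
have {}nt : 1 < l%:R * tau + m.+1%:R * tau by rewrite -mulrDl -nE.
have t1 : tau + 1 != 0 by rewrite gt_eqF// addr_gt0.
rewrite /s_lower -/n leNgt ntau/= -natr1 nE.
have tauP : (tau <= l%:R^-1) = (l%:R * tau <= 1) by rewrite -[l%:R^-1]mulr1 ler_pdivlMl.
rewrite tauP; have [ltau|taul] := ltP (l%:R * tau) 1.
  rewrite (ltW ltau); set s := (X in 0 < X).
  have sE : s * (1 + tau) = m.+1%:R + 1 - l%:R * tau by rewrite /s; field.
  have s0 : 0 < s by rewrite -(pmulr_lgt0 _ (_ : 0 < 1 + tau)) ?sE; lra.
  have sm : s < m.+1%:R by rewrite -(ltr_pM2r (_ : 0 < 1 + tau)) ?sE; lra.
  split=> //.
  apply: (@hausdorff_measure_fiber R l m tau ((1 - l%:R * tau) / m.+1%:R)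
    (2 * (2 ^+ l) `^ m.+1%:R^-1)) => //.
  - by rewrite divr_ge0 ?subr_ge0 ?ltW.
  - by rewrite ler_pdivrMr//; lra.
  - have : 1 <= (2 ^+ l) `^ m.+1%:R^-1 :> R.
      by rewrite powR_ge1 ?exprn_ege1 ?invr_ge0 ?(ltW mR) ?ler1n.
    lra.
  - by rewrite sE mulrDr mulr1 mulrCA divff ?gt_eqF// mulr1 addrA.
  - by move=> y k; exact: dirichlet_weighted.
(* The boundary l tau = 1 falls here although [s_lower] has it in the middle branch; the two
   formulas agree there. *)
set s := (X in 0 < X).
have sE : s * (1 + tau) = m.+1%:R.
  rewrite /s; case: ifPn => [h|_]; last by field.
  have ltau : l%:R * tau = 1 by apply/eqP; rewrite eq_le h.
  by transitivity (m.+1%:R + 1 - l%:R * tau); [field|rewrite ltau addrK].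
have s0 : 0 < s by rewrite -(pmulr_lgt0 _ (_ : 0 < 1 + tau)) ?sE; lra.
have sm : s < m.+1%:R.
  rewrite -(ltr_pM2r (_ : 0 < 1 + tau)) ?sE; last lra.
  by rewrite mulrDr mulr1 ltrDl mulr_gt0.
split=> //.
apply: (@hausdorff_measure_fiber R l m tau 0 1) => //.
- exact: ltW.
- by rewrite addr0 mulr1.
(* Here sigma = 0: for any [q] provided by [alpha], rounding down the coordinates of [q *: y] leaves
   errors at most 1. *)
move=> y k; have [q kq [q0 qa]] := (infinite_set_natP _).1 ainf k.
exists q; split=> //; exists (\row_j Num.floor (q%:R * y ord0 j)) => j.
rewrite mxE oppr0 powRr0 mul1r ger0_norm ?subr_ge0 ?floor_le//.
rewrite lerBlDr -[1]/(1%:~R) addrC -intrD; apply: ltW; exact: floorD1_gt.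
Qed.
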